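(* Let $m\in\mathbb N$ and suppose $A_1,\dots,A_m\subset\mathbb N_0$ form an $m$-part sum system. Then for each $j\in\{1,\dots,m\}$, $A_j=(\max A_j)-A_j$, i.e. $x\in A_j$ if and only if $\max A_j-x\in A_j$. Moreover, if all component sets $A_j$ have odd cardinality, then $\max A_j$ is even for every $j$; if at least one component set has even cardinality, then $\max A_j$ is odd for exactly one $j\in\{1,\dots,m\}$.
   Context: $\mathbb N=\{1,2,\dots\}$, $\mathbb N_0=\mathbb N\cup\{0\}$, $\langle N\rangle=\{0,1,\dots,N-1\}$; $A+B=\{x+y:x\in A,y\in B\}$, $c-A=\{c-x:x\in A\}$. An $m$-part sum system is a collection of finite sets $A_1,\dots,A_m\subset\mathbb N_0$, each of cardinality at least 2, with $\sum_{k=1}^mA_k=\langle\prod_{k=1}^m|A_k|\rangle$. *)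

(* Defs.v *)
From HB Require Import structures.
From mathcomp Require Import all_boot all_order finmap.

Set Implicit Arguments.
Unset Strict Implicit.
Unset Printing Implicit Defensive.

Local Open Scope fset_scope.
Local Open Scope nat_scope.

Definition interval0 (N : nat) : {fset nat} := [fset x in iota 0 N].

Definition sumset (A B : {fset nat}) : {fset nat} :=
  [fset x + y | x in A, y in B].

(* [fset 0] is the neutral element of sumset. *)
Definition big_sumset (m : nat) (A : 'I_m -> {fset nat}) : {fset nat} :=
  \big[sumset/[fset 0]]_(k < m) A k.

Definition sum_system (m : nat) (A : 'I_m -> {fset nat}) : Prop :=
  (forall k : 'I_m, 2 <= #|` A k|) /\
  big_sumset A = interval0 (\prod_(k < m) #|` A k|).

(* Equal to 0 on the empty set. *)
Definition fset_max (A : {fset nat}) : nat := \max_(x <- A) x.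

(* c - A; the subtraction is truncated, so this is the usual set only when
   every element of A is at most c, as is the case for c = fset_max A. *)
Definition csub (c : nat) (A : {fset nat}) : {fset nat} :=
  [fset c - x | x in A].

(* Main.v *)
Require Import Defs.
From HB Require Import structures.
From mathcomp Require Import all_boot all_order finmap.
From mathcomp Require Import all_algebra all_field.

(** Encode a finite set [A] by the polynomial [\sum_(x in A) 'X^x]. In a sum
    system the cardinalities force every sum to be attained only once, so the
    product of these polynomials is [1 + 'X + ... + 'X^(N-1)], a divisor of the
    separable polynomial ['X^N - 1]. Hence each factor has simple roots on the
    unit circle and real coefficients, so that its roots are stable under
    [z |-> z^* = z^-1]; it is therefore associated to its reciprocal
    polynomial, which encodes [max A - A]. If [max A] is odd, this symmetry
    forces [-1] to be a root, and a simple root of the product cannot be shared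
    by two factors: at most one maximum is odd. As the maxima add up to
    [N - 1], one of them is odd precisely when [N] is even. *)

Set Implicit Arguments.
Unset Strict Implicit.
Unset Printing Implicit Defensive.

Import Order.TTheory GRing.Theory Num.Theory.

Local Open Scope fset_scope.
Local Open Scope nat_scope.

Lemma odd_sum_unique (I : finType) (F : I -> nat) :
    (forall i j, odd (F i) -> odd (F j) -> i = j) ->
  odd (\sum_i F i) = [exists i, odd (F i)].
Proof.
move=> uniqF; rewrite (big_morph odd oddD (erefl : odd 0 = false)).
case: existsP => [[i oddi] | evenF]; last first.
  by apply: big1 => i _; apply/negP => oddi; apply: evenF; exists i.
rewrite (bigD1 i) //= oddi big1 // => j /eqP neq_ji.
by apply/negP => oddj; apply: neq_ji; apply: uniqF.
Qed.

(** * Finite sets of natural numbers *)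

Lemma leq_fset_max (A : {fset nat}) (x : nat) : x \in A -> x <= fset_max A.
Proof. by move=> xA; rewrite /fset_max leq_bigmax_seq. Qed.

Lemma fset_max_in (A : {fset nat}) : A != fset0 -> fset_max A \in A.
Proof.
rewrite -cardfs_gt0 cardfE /fset_max big_seq_fsetE /= => A_gt0.
by have [x ->] := bigop.eq_bigmax val A_gt0; apply: valP.
Qed.

Lemma mem_csub (c : nat) (A : {fset nat}) (x : nat) :
    (forall y, y \in A -> y <= c) ->
  (x \in csub c A) = (x <= c) && (c - x \in A).
Proof.
move=> Ac; apply/imfsetP/andP => [[y /= yA ->] | [xc cxA]].
  by rewrite leq_subr subKn ?Ac.
by exists (c - x); rewrite //= subKn.
Qed.

Lemma mem_interval0 (N n : nat) : (n \in interval0 N) = (n < N).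
Proof. by rewrite !inE mem_iota. Qed.

Lemma fset_max_interval0 (N : nat) : fset_max (interval0 N.+1) = N.
Proof.
apply/eqP; rewrite eqn_leq leq_fset_max ?mem_interval0 // andbT.
by apply/bigmax_leqP_seq => n; rewrite mem_interval0.
Qed.

Lemma card_interval0 (N : nat) : #|` interval0 N| = N.
Proof. by rewrite card_fseq undup_id ?iota_uniq // size_iota. Qed.

Lemma sumsetE (A B : {fset nat}) :
  sumset A B = [fset n in [seq x + y | x <- A, y <- B]].
Proof.
apply/fsetP => n; rewrite inE; apply/imfset2P/allpairsP.
  by case=> x xA [y yB ->]; exists (x, y).
by case=> -[x y] [xA yB ->]; exists x => //; exists y.
Qed.

Lemma leq_card_sumset (A B : {fset nat}) :
  #|` sumset A B| <= #|` A| * #|` B|.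
Proof. by rewrite sumsetE card_fseq -(size_allpairs addn) size_undup. Qed.

Lemma sum0fset : left_zero fset0 sumset.
Proof.
move=> B; apply/cardfs0_eq/eqP; rewrite -leqn0.
by apply: leq_trans (leq_card_sumset fset0 B) _; rewrite cardfs0.
Qed.

Lemma leq_card_big_sumset (I : Type) (r : seq I) (A : I -> {fset nat}) :
  #|` \big[sumset/[fset 0]]_(i <- r) A i| <= \prod_(i <- r) #|` A i|.
Proof.
apply: (big_ind2 (fun S n => #|` S| <= n)) => //; first by rewrite cardfs1.
move=> S s T t card_S card_T; apply: leq_trans (leq_card_sumset S T) _.
exact: leq_mul.
Qed.

Lemma mem0_sumset (A B : {fset nat}) :
  (0 \in sumset A B) = (0 \in A) && (0 \in B).
Proof.
apply/imfset2P/andP => [[x /= xA [y /= yB /esym/eqP]] | [A0 B0]].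
  by rewrite addn_eq0 => /andP[/eqP x0 /eqP y0]; rewrite -{1}x0 -y0.
by exists 0 => //; exists 0.
Qed.

Lemma mem0_big_sumset (m : nat) (A : 'I_m -> {fset nat}) :
  (0 \in big_sumset A) = [forall k, 0 \in A k].
Proof.
rewrite (big_morph (fun S : {fset nat} => 0 \in S) mem0_sumset (fset11 0)).
by rewrite big_andE.
Qed.

(** * Reciprocal polynomials *)

Local Open Scope ring_scope.

Definition revpoly (R : nzSemiRingType) (p : {poly R}) : {poly R} :=
  \poly_(i < size p) p`_((size p).-1 - i).

Lemma size_revpoly (R : nzSemiRingType) (p : {poly R}) :
  p`_0 != 0 -> size (revpoly p) = size p.
Proof. by move=> p0; rewrite size_poly_eq // subnn. Qed.

Lemma horner_revpoly (R : comUnitRingType) (p : {poly R}) (z : R) :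
  z \is a GRing.unit -> (revpoly p).[z] = z ^+ (size p).-1 * p.[z^-1].
Proof.
move=> Uz; rewrite horner_poly horner_coef mulr_sumr.
case: (size p) => [|n]; first by rewrite !big_ord0.
rewrite (reindex_inj rev_ord_inj); apply: eq_bigr => i _ /=.
have le_in : (i <= n)%N by rewrite -ltnS.
by rewrite subSS subKn // exprB // exprVn mulrCA.
Qed.

Lemma root_revpoly (F : fieldType) (p : {poly F}) (z : F) :
  z != 0 -> root (revpoly p) z = root p z^-1.
Proof.
move=> z0; rewrite !rootE horner_revpoly ?unitfE //.
by rewrite mulf_eq0 expf_eq0 (negPf z0) andbF.
Qed.

Lemma root_revpoly_opp1 (R : idomainType) (p : {poly R}) :
    2%:R != 0 :> R -> revpoly p = p -> ~~ odd (size p) -> root p (-1).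
Proof.
move=> nz2 rev_p even_p; have [-> | nz_p] := eqVneq p 0; first exact: root0.
have := horner_revpoly p (unitrN1 R).
rewrite rev_p invrN1 -signr_odd -(negbK (odd _)) -oddS.
rewrite prednK ?lt0n ?size_poly_eq0 // even_p expr1 mulN1r => /eqP.
by rewrite -addr_eq0 -mulr2n -mulr_natl mulf_eq0 (negPf nz2).
Qed.

Lemma separable_dvdp_root (F : closedFieldType) (p q : {poly F}) :
  separable_poly p -> (forall z, root p z -> root q z) -> p %| q.
Proof.
move=> sep_p root_pq; have nz_p := separable_poly_neq0 sep_p.
have [r def_p] := closed_field_poly_normal p.
have eqp_r : p %= \prod_(z <- r) ('X - z%:P).
  by rewrite {1}def_p eqp_scale // lead_coef_eq0.
rewrite (eqp_dvdl _ eqp_r); apply: uniq_roots_dvdp.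
  by apply/allP => z zr; rewrite root_pq // (eqp_root eqp_r) root_prod_XsubC.
by rewrite uniq_rootsE -separable_prod_XsubC -(eqp_separable eqp_r).
Qed.

Section RealPolynomial.

Variables (C : numClosedFieldType) (p : {poly C}).
Hypothesis real_p : p \is a polyOver Num.real.

Lemma root_conjC (z : C) : root p z^* = root p z.
Proof.
have conj_p : map_poly Num.conj p = p.
  by apply: map_poly_id => a /(allP real_p) real_a; apply: conj_Creal.
by rewrite !rootE -{1}conj_p horner_map fmorph_eq0.
Qed.

Lemma eqp_revpoly :
    separable_poly p -> (forall z, root p z -> `|z| = 1) -> p %= revpoly p.
Proof.
move=> sep_p norm1.
have nz_root z : root p z -> z != 0.
  by move/norm1=> nz1; rewrite -normr_eq0 nz1 oner_neq0.
have nz_p0 : p`_0 != 0.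
  by rewrite -horner_coef0; apply/negP => /nz_root; rewrite eqxx.
rewrite -dvdp_size_eqp ?size_revpoly //.
apply: separable_dvdp_root => // z pz0.
rewrite root_revpoly ?nz_root // invC_norm norm1 // expr1n invr1 mul1r.
by rewrite root_conjC.
Qed.

Lemma eqp_revpoly_dvd_Xn_sub1 (N : nat) :
  (0 < N)%N -> p %| 'X^N - 1 -> p %= revpoly p.
Proof.
move=> N_gt0 dvd_p; apply: eqp_revpoly => [|z /(root_dvdp dvd_p)].
  apply: dvdp_separable dvd_p _; apply: separable_Xn_sub_1.
  by rewrite pnatr_eq0 -lt0n.
rewrite rootE !hornerE subr_eq0 => /eqP zN1.
by apply/eqP; rewrite -(pexpr_eq1 N_gt0) // -normrX zN1 normr1.
Qed.

End RealPolynomial.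

(** * The polynomial encoding a finite set *)

Definition fset_poly (R : nzSemiRingType) (A : {fset nat}) : {poly R} :=
  \sum_(x <- A) 'X^x.

Section FsetPoly.

Variable R : nzSemiRingType.
Implicit Types A B : {fset nat}.

Lemma coef_fset_poly A (n : nat) : (fset_poly R A)`_n = (n \in A)%:R.
Proof.
rewrite coef_sum; under eq_bigr => x _ do rewrite coefXn eq_sym.
rewrite -natr_sum -(count_uniq_mem n (fset_uniq A)) -sum1_count.
by rewrite [in RHS]big_mkcond.
Qed.

Lemma fset_poly_inj : injective (fset_poly R).
Proof.
move=> A B eqAB; apply/fsetP => n.
have := congr1 (fun p : {poly R} => p`_n) eqAB; rewrite !coef_fset_poly => /eqP.
by do 2!case: (n \in _); rewrite //= ?[_%:R == 1]eq_sym oner_eq0.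
Qed.

Lemma size_fset_poly A : A != fset0 -> size (fset_poly R A) = (fset_max A).+1.
Proof.
move=> An0; apply/eqP; rewrite eqn_leq; apply/andP; split.
  apply/leq_sizeP => n lt_max_n; rewrite coef_fset_poly.
  by case: (boolP (n \in A)) => // /leq_fset_max; rewrite leqNgt lt_max_n.
rewrite ltnNge; apply/leq_sizeP => /(_ _ (leqnn _))/eqP.
by rewrite coef_fset_poly fset_max_in // oner_eq0.
Qed.

Lemma monic_fset_poly A : A != fset0 -> fset_poly R A \is monic.
Proof.
move=> An0; rewrite monicE lead_coefE size_fset_poly //.
by rewrite coef_fset_poly fset_max_in.
Qed.

Lemma revpoly_fset_poly A :
  A != fset0 -> revpoly (fset_poly R A) = fset_poly R (csub (fset_max A) A).
Proof.
move=> An0; apply/polyP => n; rewrite coef_poly size_fset_poly //= ltnS.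
rewrite !coef_fset_poly (mem_csub _ (@leq_fset_max A)).
by case: (n <= _)%N.
Qed.

Lemma fset_poly_sumset A B :
    #|` sumset A B| = (#|` A| * #|` B|)%N ->
  fset_poly R (sumset A B) = fset_poly R A * fset_poly R B.
Proof.
rewrite sumsetE card_fseq -(size_allpairs addn) => size_eq.
have uniqAB : uniq [seq (x + y)%N | x <- A, y <- B].
  by rewrite -[uniq _]negbK -ltn_size_undup size_eq ltnn.
rewrite /fset_poly (perm_big [seq (x + y)%N | x <- A, y <- B]); last first.
  by apply: uniq_perm (fset_uniq _) uniqAB _ => n; rewrite inE.
rewrite big_allpairs_dep mulr_suml; apply: eq_bigr => x _.
by rewrite mulr_sumr; apply: eq_bigr => y _; rewrite exprD.
Qed.

Lemma fset_poly_big_sumset (I : Type) (r : seq I) (A : I -> {fset nat}) :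
    #|` \big[sumset/[fset 0%N]]_(i <- r) A i| = (\prod_(i <- r) #|` A i|)%N ->
  fset_poly R (\big[sumset/[fset 0%N]]_(i <- r) A i)
    = \prod_(i <- r) fset_poly R (A i).
Proof.
elim: r => [|i r IHr]; first by rewrite !big_nil /fset_poly big_seq_fset1.
rewrite !big_cons; have [-> _ | An0] := eqVneq (A i) fset0.
  by rewrite sum0fset /fset_poly !big_nil mul0r.
have A_gt0 : (0 < #|` A i|)%N by rewrite cardfs_gt0.
set S := \big[sumset/_]_(j <- r) A j => cardAS.
have cardS : #|` S| = (\prod_(j <- r) #|` A j|)%N.
  apply/eqP; rewrite eqn_leq leq_card_big_sumset -(leq_pmul2l A_gt0).
  by rewrite -cardAS leq_card_sumset.
by rewrite fset_poly_sumset ?IHr // cardAS cardS.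
Qed.

Lemma fset_poly_interval0 (N : nat) :
  fset_poly R (interval0 N) = \sum_(i < N) 'X^i.
Proof.
rewrite -(big_mkord xpredT (fun i => 'X^i : {poly R})) /index_iota subn0.
apply/perm_big/uniq_perm; rewrite ?fset_uniq ?iota_uniq // => n.
by rewrite inE.
Qed.

End FsetPoly.

Lemma real_fset_poly (C : numDomainType) (A : {fset nat}) :
  fset_poly C A \is a polyOver Num.real.
Proof. by apply/polyOverP => n; rewrite coef_fset_poly realn. Qed.

Lemma csub_fset_max_id (C : numClosedFieldType) (N : nat) (A : {fset nat}) :
    (0 < N)%N -> fset_poly C A %| 'X^N - 1 -> 0%N \in A ->
  csub (fset_max A) A = A.
Proof.
move=> N_gt0 dvdA A0; have An0 : A != fset0 by apply/fset0Pn; exists 0%N.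
apply: (@fset_poly_inj C); apply/esym/eqP.
rewrite -eqp_monic ?monic_fset_poly //; last first.
  apply/fset0Pn; exists (fset_max A).
  by rewrite (mem_csub _ (@leq_fset_max A)) leqnn subnn.
rewrite -revpoly_fset_poly //.
exact: (eqp_revpoly_dvd_Xn_sub1 (real_fset_poly C A) N_gt0 dvdA).
Qed.

Lemma root_fset_poly_opp1 (C : numDomainType) (A : {fset nat}) :
  csub (fset_max A) A = A -> odd (fset_max A) -> root (fset_poly C A) (-1).
Proof.
move=> symA odd_max.
have An0 : A != fset0.
  by apply: contraTneq odd_max => ->; rewrite /fset_max big_nil.
apply: root_revpoly_opp1; first by rewrite pnatr_eq0.
  by rewrite revpoly_fset_poly ?symA.
by rewrite size_fset_poly //= odd_max.
Qed.

(** * Sum systems *)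

Section SumSystem.

Variables (m : nat) (A : 'I_m -> {fset nat}).
Hypothesis hA : sum_system A.
Let N := (\prod_(k < m) #|` A k|)%N.

Lemma sum_system_gt0 : (0 < N)%N.
Proof. by apply: prodn_gt0 => k; apply: leq_trans (hA.1 k). Qed.

Lemma sum_system_neq0 (k : 'I_m) : A k != fset0.
Proof. by rewrite -cardfs_gt0; apply: leq_trans (hA.1 k). Qed.

Lemma sum_system_mem0 (k : 'I_m) : 0%N \in A k.
Proof.
by apply/forallP: k; rewrite -mem0_big_sumset hA.2 mem_interval0 sum_system_gt0.
Qed.

Lemma sum_system_prod (R : nzSemiRingType) :
  \prod_(k < m) fset_poly R (A k) = fset_poly R (interval0 N).
Proof.
rewrite -hA.2 [RHS]fset_poly_big_sumset // -/(big_sumset A) hA.2.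
exact: card_interval0.
Qed.

Lemma sum_system_sum_max : (\sum_(k < m) fset_max (A k)).+1 = N.
Proof.
have size_prod_poly : size (\prod_(k < m) fset_poly int (A k)) = N.
  rewrite sum_system_prod -(prednK sum_system_gt0) size_fset_poly.
    by rewrite fset_max_interval0.
  by apply/fset0Pn; exists 0%N; rewrite mem_interval0.
rewrite -size_prod_poly size_prod => [|k _]; last first.
  by rewrite monic_neq0 ?monic_fset_poly ?sum_system_neq0.
rewrite [in RHS](eq_bigr (fun k => fset_max (A k) + 1)%N) => [|k _].
  by rewrite big_split sum1_card -addSn addnK.
by rewrite size_fset_poly ?sum_system_neq0 // addn1.
Qed.

Lemma sum_system_prod_dvdp (R : idomainType) :
  \prod_(k < m) fset_poly R (A k) %| 'X^N - 1.
Proof. by rewrite sum_system_prod fset_poly_interval0 subrX1 dvdp_mulIr. Qed.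

Lemma sum_system_csub (k : 'I_m) : csub (fset_max (A k)) (A k) = A k.
Proof.
apply: (@csub_fset_max_id algC) sum_system_gt0 _ (sum_system_mem0 k).
by apply: dvdp_trans (sum_system_prod_dvdp _); rewrite (bigD1 k) //= dvdp_mulIl.
Qed.

Lemma sum_system_odd_max_unique (j k : 'I_m) :
  odd (fset_max (A j)) -> odd (fset_max (A k)) -> j = k.
Proof.
have root_opp1 i : odd (fset_max (A i)) -> root (fset_poly algC (A i)) (-1).
  exact: root_fset_poly_opp1 (sum_system_csub i).
move=> /root_opp1 root_j /root_opp1; apply: contraTeq => neq_jk.
have sepN : separable_poly ('X^N - 1 : {poly algC}).
  by apply: separable_Xn_sub_1; rewrite pnatr_eq0 -lt0n sum_system_gt0.
apply: coprimep_root root_j.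
apply: separable_coprime sepN _; apply: dvdp_trans (sum_system_prod_dvdp _).
by rewrite (bigD1 j) //= (bigD1 k) 1?eq_sym //= mulrA dvdp_mulIl.
Qed.

Lemma sum_system_odd_maxE :
  [exists k, odd (fset_max (A k))] = [exists k, ~~ odd #|` A k|].
Proof.
rewrite -odd_sum_unique; last exact: sum_system_odd_max_unique.
rewrite -[LHS]negbK -oddS sum_system_sum_max.
by rewrite (big_morph odd oddM (erefl : odd 1 = true)) big_andE negb_forall.
Qed.

End SumSystem.

Local Close Scope ring_scope.

Theorem theorem1 (m : nat) (hm : 0 < m) (A : 'I_m -> {fset nat})
    (hA : sum_system A) :
  (forall j : 'I_m,
     A j = csub (fset_max (A j)) (A j) /\
     (forall x : nat,
        x \in A j <->
        x <= fset_max (A j) /\ fset_max (A j) - x \in A j)) /\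
  ((forall j : 'I_m, odd #|` A j|) ->
   forall j : 'I_m, ~~ odd (fset_max (A j))) /\
  ((exists j : 'I_m, ~~ odd #|` A j|) ->
   exists! j : 'I_m, odd (fset_max (A j))).
Proof.
split=> [j|].
  have symA := sum_system_csub hA j; split=> // x.
  rewrite -{1}symA (mem_csub _ (@leq_fset_max _)).
  by split=> /andP.
split=> [oddA j | /existsP].
  apply/negP => odd_j; have : [exists k, odd (fset_max (A k))].
    by apply/existsP; exists j.
  by rewrite (sum_system_odd_maxE hA) => /existsP[k]; rewrite oddA.
rewrite -(sum_system_odd_maxE hA) => /existsP[k odd_k].
by exists k; split=> // j; apply: sum_system_odd_max_unique.
Qed.
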